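(* Let $1\le n<\omega$ and let $\mathcal A=(A;E_0,\dots,E_{n-1})$ be an $n$-indexed hyperspace. Then $\mathcal A$ is twisted if and only if $\mathcal A$ has an acceptable coloring.
   Context: For a finite set $I\subseteq\omega$, an $I$-indexed hyperspace is a structure $\mathcal A=(A;E_i)_{i\in I}$ in which each $E_i$ is an equivalence relation on $A$; an $n$-indexed hyperspace is an $I$-indexed hyperspace with $I=n=\{0,1,\dots,n-1\}$. For $a\in A$, $[a]_i$ denotes the $E_i$-equivalence class of $a$. A coloring of an $I$-indexed hyperspace is a function $\chi:A\to I$; it is acceptable if for every $a\in A$ and $i\in I$ the set $\{x\in[a]_i:\chi(x)=i\}$ is finite. For $J\subseteq I$, $\mathcal A\upharpoonright J$ is the $J$-indexed hyperspace $(A;E_j)_{j\in J}$; for $B\subseteq A$, $\mathcal A|B$ is the substructure with universe $B$ (the $E_i$ restricted to $B$). If $|A|=\kappa>\aleph_0$, a filtration for $\mathcal A$ is a sequence $\langle A_\alpha:\alpha<\kappa\rangle$ of subsets of $A$ with each $|A_\alpha|<\kappa$ such that $\langle \mathcal A|A_\alpha:\alpha<\kappa\rangle$ is an increasing, continuous chain of elementary substructures of $\mathcal A$ whose union is $\mathcal A$. Twisted is defined by recursion on cardinality: an $I$-indexed hyperspace $\mathcal A$ with $|A|=\kappa$ is twisted if (0) $\bigcap_{i\in I}[a]_i$ is finite for every $a\in A$, and either (1) $A$ is countable, or (2) $\kappa>\aleph_0$ and there is a filtration $\langle A_\alpha:\alpha<\kappa\rangle$ for $\mathcal A$ such that $\mathcal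 A|A_0$ is twisted and, whenever $\alpha<\kappa$, $\emptyset\ne J\subseteq I$ and $B=\{x\in A_{\alpha+1}\setminus A_\alpha:\forall i\in I\,(i\in J\leftrightarrow [x]_i\cap A_\alpha=\emptyset)\}$, the $J$-indexed hyperspace $(\mathcal A|B)\upharpoonright J$ is twisted. *)

(* Defs.v *)
From Corelib Require Import RelationClasses.
From mathcomp Require Import all_boot finmap all_classical wochoice.

Set Implicit Arguments.
Unset Strict Implicit.
Unset Printing Implicit Defensive.

Local Open Scope classical_set_scope.
Local Open Scope card_scope.

Record hyperspace (I : {fset nat}) := Hyperspace {
  carrier :> Type;
  rel_of : I -> carrier -> carrier -> Prop;
  rel_of_equiv : forall i, Equivalence (rel_of i)
}.

Definition eqclass (I : {fset nat}) (A : hyperspace I) (i : I) (a : A) : set A :=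
  [set x | rel_of i a x].

Definition nindex (n : nat) : {fset nat} := [fset k in iota 0 n]%fset.

Definition acceptable (I : {fset nat}) (A : hyperspace I) (chi : A -> I) : Prop :=
  forall (a : A) (i : I), finite_set [set x | eqclass i a x /\ chi x = i].

Lemma reduct_equiv (I J : {fset nat}) (JI : (J `<=` I)%fset) (A : hyperspace I)
  (j : J) : Equivalence (@rel_of I A (fincl JI j)).
Proof. exact: rel_of_equiv. Qed.

Definition reduct (I J : {fset nat}) (JI : (J `<=` I)%fset) (A : hyperspace I) :
    hyperspace J :=
  Hyperspace (reduct_equiv JI A).

Lemma restrict_equiv (I : {fset nat}) (A : hyperspace I) (B : set A) (i : I) :
  Equivalence (fun x y : set_type B => rel_of i (val x) (val y)).
Proof.
have [r s t] := rel_of_equiv A i.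
by split=> [x|x y|x y z]; [exact: r|exact: s|exact: t].
Qed.

Definition restrict (I : {fset nat}) (A : hyperspace I) (B : set A) :
    hyperspace I :=
  Hyperspace (restrict_equiv B).

(* First-order formulas over equality and the symbols E_i, with free de Bruijn
   variables in 'I_k. Scoping the variables makes sentences evaluable in the
   empty structure, so that the empty set is not an elementary substructure of
   a nonempty one. *)
Inductive formula (I : Type) : nat -> Type :=
| FEq k of 'I_k & 'I_k : formula I k
| FRel k of I & 'I_k & 'I_k : formula I k
| FNot k of formula I k : formula I k
| FAnd k of formula I k & formula I k : formula I k
| FEx k of formula I k.+1 : formula I k.

Definition vcons (T : Type) (k : nat) (x : T) (v : 'I_k -> T) : 'I_k.+1 -> T :=
  fun i => if unlift ord0 i is Some j then v j else x.

Fixpoint sat (I : {fset nat}) (A : hyperspace I) (k : nat) (phi : formula I k) :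
    ('I_k -> A) -> Prop :=
  match phi in formula _ k return ('I_k -> A) -> Prop with
  | FEq _ x y => fun v => v x = v y
  | FRel _ i x y => fun v => rel_of i (v x) (v y)
  | FNot _ p => fun v => ~ sat p v
  | FAnd _ p q => fun v => sat p v /\ sat q v
  | FEx _ p => fun v => exists a : A, sat p (vcons a v)
  end.

Definition elementary (I : {fset nat}) (A : hyperspace I) (B : set A) : Prop :=
  forall (k : nat) (phi : formula I k) (v : 'I_k -> restrict B),
    sat phi v <-> sat phi (fun i => val (v i) : A).

Definition card_lt (T U : Type) (X : set T) (Y : set U) : Prop :=
  X #<= Y /\ ~ (Y #<= X).

Definition slt (K : eqType) (le : rel K) (a b : K) : Prop := le a b /\ a <> b.

Definition is_zero (K : eqType) (le : rel K) (a : K) : Prop :=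
  forall b, ~ slt le b a.

Definition is_succ (K : eqType) (le : rel K) (a b : K) : Prop :=
  slt le a b /\ forall c, slt le a c -> le b c.

Definition is_limit (K : eqType) (le : rel K) (b : K) : Prop :=
  ~ is_zero le b /\ forall a, ~ is_succ le a b.

(* A well-order isomorphic to an initial ordinal, i.e. to a cardinal. *)
Definition initial_order (K : eqType) (le : rel K) : Prop :=
  well_order le /\ forall a, card_lt [set b | slt le b a] [set: K].

(* The cardinal |A| is represented by any well-order (K, le) whose order type is
   an initial ordinal and which is equipotent to A; it is unique up to
   isomorphism. *)
Record filtration (I : {fset nat}) (A : hyperspace I) := Filtration {
  fidx : eqType;
  fle : rel fidx;
  fidx_initial : initial_order fle;
  fidx_card : [set: fidx] #= [set: A];
  fset_at :> fidx -> set A;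
  fset_at_card : forall a, card_lt (fset_at a) [set: A];
  fset_at_elementary : forall a, elementary (fset_at a);
  fset_at_increasing : forall a b, fle a b -> fset_at a `<=` fset_at b;
  fset_at_continuous : forall b, is_limit fle b ->
    fset_at b = \bigcup_(a in [set a | slt fle a b]) fset_at a;
  fset_at_union : \bigcup_(a in [set: fidx]) fset_at a = [set: A]
}.

(* The points added between A_alpha = X and A_(alpha+1) = Y whose E_i-class is
   new exactly for i in J. *)
Definition new_part (I : {fset nat}) (A : hyperspace I) (X Y : set A)
    (J : {fset nat}) : set A :=
  [set x | [/\ Y x, ~ X x &
    forall i : I, val i \in J <-> eqclass i x `&` X = set0]].

(* A_0 and the new parts below have cardinality < |A|, so this inductive
   predicate is the solution of the recursion on cardinality. *)
Inductive twisted (I : {fset nat}) (A : hyperspace I) : Prop :=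
| twisted_countable :
    (forall a : A, finite_set (\bigcap_(i in [set: I]) eqclass i a)) ->
    countable [set: A] ->
    twisted A
| twisted_uncountable (F : filtration A) :
    (forall a : A, finite_set (\bigcap_(i in [set: I]) eqclass i a)) ->
    ~ countable [set: A] ->
    (forall z, is_zero (@fle _ _ F) z -> twisted (restrict (F z))) ->
    (forall (a a' : fidx F) (J : {fset nat}) (JI : (J `<=` I)%fset),
        is_succ (@fle _ _ F) a a' -> J <> fset0 ->
        twisted (reduct JI (restrict (new_part (F a) (F a') J)))) ->
    twisted A.

(* Main.v *)
Require Import Defs.
From mathcomp Require Import all_boot finmap all_classical wochoice.
From Stdlib Require List.

(** Given an acceptable coloring chi, close initial segments of an enumeration of
    A of order type |A| under Skolem functions and under the finite sets
    {y in [b]_i : chi y = i}. A point x outside A_alpha whose E_i-class meets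
    A_alpha cannot have color i, so chi is acceptable on every new part with its
    smaller set of indices, and induction on |A| applies.

    Conversely, a countable A is colored by giving x an index i for which the code
    of [x]_i is largest: then bounding the code of [x]_i bounds all of them. In the
    uncountable case, elementarity and finiteness of the intersections give every
    point of A_(alpha+1) outside A_alpha some new class, so the colorings of the
    new parts can be glued. A point of color i then appears exactly when its
    E_i-class first does, so each class gains color i at only one stage. *)

Set Implicit Arguments.
Unset Strict Implicit.
Unset Printing Implicit Defensive.

Local Open Scope classical_set_scope.
Local Open Scope card_scope.

(** * Cardinals *)

Lemma card_leTTP (T U : Type) :
  [set: T] #<= [set: U] <-> exists f : T -> U, injective f.
Proof.
split=> [/card_leP[f]|[f fI]].
  exists (fun x => set_val (f (SigSub (mem_set (Logic.I : [set: T] x))))).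
  move=> x y /val_inj /(inj (in_setT _) (in_setT _)).
  by move=> /(congr1 set_val).
rewrite -(card_le_eql (inj_card_eq (in2W fI))); exact: card_leT.
Qed.

Lemma card_leTsetP (T U : Type) (B : set U) :
  [set: T] #<= B <-> exists2 f : T -> U, injective f & forall x, B (f x).
Proof.
rewrite -(card_le_eqr (card_setT B)); split=> [/card_leTTP[f fI]|[f fI fB]].
  by exists (set_val \o f) => [x y /val_inj/fI//|x]; exact: set_valP.
apply/card_leTTP; exists (fun x => SigSub (mem_set (fB x))) => x y.
by move=> /(congr1 set_val) /fI.
Qed.

(* A maximal set Y of choice functions, any two of which differ on every member
   of P, projects onto some member of P, and it injects into all of them. *)
Lemma card_min (T : Type) (P : set T -> Prop) (S0 : set T) : P S0 ->
  exists2 S, P S & forall S', P S' -> S #<= S'.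
Proof.
move=> PS0.
pose ok (Y : set (set T -> T)) :=
  (forall f S, Y f -> P S -> S (f S)) /\
  (forall f g S, Y f -> Y g -> P S -> f S = g S -> f = g).
have [F FP Ftot|Y [[Yin Yinj] Ymax]] := @Zorn_bigcup _ ok.
  split=> [f S [X FX Xf] PS|f g S [X FX Xf] [X' FX' X'g] PS].
    by have [h _] := FP _ FX; exact: (h f S).
  have [XX'|XX'] := Ftot _ _ FX FX'.
    by have [_ h] := FP _ FX'; apply: (h f g S) => //; exact: XX'.
  by have [_ h] := FP _ FX; apply: (h f g S) => //; exact: XX'.
have [S [PS SY]] : exists S, P S /\ S `<=` [set f S | f in Y].
  apply: contrapT => /forallNP nex.
  have ex S : P S -> exists x, S x /\ ~ [set f S | f in Y] x.
    move=> PS; apply: contrapT => /forallNP nx; apply: (nex S); split=> // x Sx.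
    by apply: contrapT => nYx; apply: (nx x).
  have [x0 _] := ex _ PS0.
  have /choice[f fP] S : exists x, P S -> S x /\ ~ [set f S | f in Y] x.
    by have [/ex[x xP]|nPS] := pselect (P S); [exists x|exists x0].
  apply: (Ymax (Y `|` [set f])).
    split; first by move=> g gY; left.
    move=> /(_ f (or_intror erefl)) Yf.
    by have [_] := fP _ PS0; apply; exists f.
  split=> [g S [Yg|->] PS|g h S [Yg|->] [Yh|->] PS //].
  - exact: (Yin g S).
  - by have [] := fP _ PS.
  - exact: (Yinj g h S).
  - by move=> e; have [_] := fP _ PS; case; exists g.
  - by move=> e; have [_] := fP _ PS; case; exists h.
exists S => // S' PS'.
apply: card_le_trans (subset_card_le SY) _.
apply: card_le_trans (card_image_le _ _) _.
rewrite -(card_le_eql (card_setT Y)); apply/card_leTsetP.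
exists (fun f => set_val f S') => [f g e|f]; last exact: (Yin _ _ (set_valP f)).
by apply/val_inj/(Yinj _ _ S') => //; exact: set_valP.
Qed.

(** Both sets are copied into [T + U]; the smallest member that [card_min] finds in the family of
    the two copies decides which one embeds in the other. *)
Lemma card_le_total (T U : Type) (X : set T) (Y : set U) : X #<= Y \/ Y #<= X.
Proof.
have cl : @inl T U @` X #= X.
  by apply: inj_card_eq => x y _ _ [].
have cr : @inr T U @` Y #= Y.
  by apply: inj_card_eq => x y _ _ [].
have [|S [] -> Smin] := @card_min (T + U)
    (fun S => S = @inl T U @` X \/ S = @inr T U @` Y)
    (@inl T U @` X); first by left.
- left; rewrite -(card_le_eql cl) -(card_le_eqr cr); apply: Smin; by right.
- right; rewrite -(card_le_eql cr) -(card_le_eqr cl); apply: Smin; by left.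
Qed.

(** Up to bijection, the types that embed in a counterexample [T] are the subsets of [T], so
    [card_min] yields a smallest counterexample. *)
Lemma card_lt_ind (P : Type -> Prop) :
  (forall T, (forall U, card_lt [set: U] [set: T] -> P U) -> P T) ->
  forall T, P T.
Proof.
move=> H T; apply: contrapT => nPT.
have [|S [U [nPU US]] Smin] := @card_min T
    (fun S => exists U, ~ P U /\ [set: U] #= S) [set: T].
  by exists T.
apply: nPU; apply: H => V [VU nUV]; apply: contrapT => nPV; apply: nUV.
have /card_leTsetP[f fI _] : [set: V] #<= S by rewrite -(card_le_eqr US).
have fV : [set: V] #= range f.
  by rewrite card_eq_sym; apply: inj_card_eq; exact: in2W fI.
by rewrite (card_le_eql US) (card_le_eqr fV); apply: Smin; exists V.
Qed.

Lemma card_le_fun (T : Type) (A B : set T) : A #<= B ->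
  exists2 f : T -> T, (forall x, A x -> B (f x)) &
    (forall x x', A x -> A x' -> f x = f x' -> x = x').
Proof.
rewrite -(card_le_eql (card_setT A)) => /card_leTsetP[f fI fB].
exists (fun x => if pselect (A x) is left Ax
                 then f (SigSub (mem_set Ax)) else x).
  by move=> x Ax; case: pselect => // ?; exact: fB.
move=> x x' Ax Ax'; case: pselect => // ?; case: pselect => // ? /fI.
by move=> /(congr1 set_val).
Qed.

Lemma infinite_nat_inj (T : Type) : infinite_set [set: T] ->
  exists e : nat -> T, injective e.
Proof. by move=> /infiniteP/card_leTTP. Qed.

Definition pairing_on (T : Type) (D : set T) (q : T -> T -> T) : Prop :=
  (forall x y, D x -> D y -> D (q x y)) /\
  (forall x y x' y', D x -> D y -> D x' -> D y' -> q x y = q x' y' ->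
     x = x' /\ y = y').

(* The domain of the partial pairing is read off the diagonal of its graph, so
   that chains of pairings can be joined by taking the union of the graphs. *)
Definition pairing_graph (T : Type) (G : set (T * T * T)) : Prop :=
  let D x := exists z, G (x, x, z) in
  [/\ forall x y, D x -> D y -> exists z, G (x, y, z),
      forall x y z, G (x, y, z) -> [/\ D x, D y & D z],
      forall x y z z', G (x, y, z) -> G (x, y, z') -> z = z' &
      forall x y x' y' z, G (x, y, z) -> G (x', y', z) -> x = x' /\ y = y'].

Lemma pairing_graph_bigcup (T : Type) (F : set (set (T * T * T))) :
  F `<=` @pairing_graph T -> total_on F subset ->
  pairing_graph (\bigcup_(G in F) G).
Proof.
move=> FP Ftot.
have F2 p p' : (\bigcup_(G in F) G) p -> (\bigcup_(G in F) G) p' ->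
    exists G, [/\ F G, G p & G p'].
  move=> [G FG Gp] [G' FG' Gp'].
  by have [s|s] := Ftot _ _ FG FG'; [exists G'|exists G]; split=> //; exact: s.
split=> [x y [z Gx] [w Gy]|x y z [G FG Gx]|x y z z' Gz Gz'|x y x' y' z Gz Gz'].
- have [G [FG {}Gx {}Gy]] := F2 _ _ Gx Gy.
  have [tot _ _ _] := FP _ FG.
  by have [||t Gt] := tot x y; [exists z|exists w|exists t; exists G].
- have [_ fld _ _] := FP _ FG; have [[a Ga] [b Gb] [c Gc]] := fld _ _ _ Gx.
  by split; [exists a|exists b|exists c]; exists G.
- have [G [FG {}Gz {}Gz']] := F2 _ _ Gz Gz'.
  by have [_ _ fn _] := FP _ FG; exact: fn Gz Gz'.
- have [G [FG {}Gz {}Gz']] := F2 _ _ Gz Gz'.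
  by have [_ _ _ ij] := FP _ FG; exact: ij Gz Gz'.
Qed.

Lemma pairing_graph_on (T : Type) (D : set T) (q : T -> T -> T) :
  pairing_on D q -> pairing_graph [set p | [/\ D p.1.1, D p.1.2 & p.2 = q p.1.1 p.1.2]].
Proof.
move=> [qD qI].
have DE x : D x -> exists z, [/\ D x, D x & z = q x x] by move=> Dx; exists (q x x).
split=> /=.
- by move=> x y [z [Dx _ _]] [w [Dy _ _]]; exists (q x y).
- by move=> x y z [Dx Dy ->]; split; apply: DE => //; exact: qD.
- by move=> x y z z' [_ _ ->] [_ _ ->].
- by move=> x y x' y' z [Dx Dy ->] [Dx' Dy']; exact: qI.
Qed.

(* Zorn's lemma yields a maximal pairing on some infinite D; if the complement
   of D did not embed in D, then D would embed in its complement, and the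
   pairing would extend to the union of D and its copy. *)
Lemma infinite_pairing (T : Type) : infinite_set [set: T] ->
  exists p : T -> T -> T, forall x y x' y', p x y = p x' y' -> x = x' /\ y = y'.
Proof.
move=> /infinite_nat_inj[e eI].
have [q0 q0P] : exists q0 : T -> T -> T, pairing_on (range e) q0.
  have /choice[d dP] (x : T) : exists n, range e x -> x = e n.
    have [[n _ <-]|ne] := pselect (range e x); [by exists n|by exists 0].
  exists (fun x y => e (choice.pickle (d x, d y))); split=> [x y _ _|x y x' y'].
    exact: imageT.
  move=> ex ey ex' ey' /eI/(pcan_inj choice.pickleK)[dx dy].
  by rewrite (dP _ ex) (dP _ ey) (dP _ ex') (dP _ ey') dx dy.
pose G0 : set (T * T * T) :=
  [set p | [/\ range e p.1.1, range e p.1.2 & p.2 = q0 p.1.1 p.1.2]].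
have G0P : pairing_graph G0 by exact: pairing_graph_on.
have G0e n : G0 (e n, e n, q0 (e n) (e n)) by split=> //=; exists n.
have [F FP Ftot|G [[GP G0G] Gmax]] := @Zorn_bigcup (T * T * T)
    (fun G => pairing_graph G /\ (G !=set0 -> G0 `<=` G)).
  split; first by apply: pairing_graph_bigcup => // G /FP[].
  move=> [p [G FG Gp]]; have [_ G0G] := FP _ FG.
  by apply: subset_trans (G0G _) (bigcup_sup _) => //; exists p.
have {G0G} G0G : G0 `<=` G.
  have [/G0G//|Ge] := pselect (G !=set0).
  exfalso; apply: (Gmax G0); last by split=> // _.
  split=> [p Gp|/(_ _ (G0e 0)) Gp]; [by case: Ge; exists p|].
  by apply: Ge; exists (e 0, e 0, q0 (e 0) (e 0)).
pose D x := exists z, G (x, x, z).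
have De n : D (e n) by exists (q0 (e n) (e n)); exact: G0G.
have [tot fld fn ij] := GP.
have [q qG] : exists q, forall x y, D x -> D y -> G (x, y, q x y).
  have /choice[q qP] (xy : T * T) :
      exists z, D xy.1 -> D xy.2 -> G (xy.1, xy.2, z).
    have [[dx dy]|ne] := pselect (D xy.1 /\ D xy.2).
      by have [z Gz] := tot _ _ dx dy; exists z.
    by exists (e 0) => dx dy; case: ne.
  by exists (fun x y => q (x, y)) => x y; exact: (qP (x, y)).
have qD x y : D x -> D y -> D (q x y).
  by move=> Dx Dy; have [] := fld _ _ _ (qG _ _ Dx Dy).
have qI x y x' y' : D x -> D y -> D x' -> D y' -> q x y = q x' y' ->
    x = x' /\ y = y'.
  move=> Dx Dy Dx' Dy' E; apply: (ij _ _ _ _ (q x y)); first exact: qG.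
  by rewrite E; exact: qG.
have tagI (b b' : bool) : e b = e b' -> b = b' by move=> /eI; case: b b' => [] [].
(* If the complement of [D] embeds in [D], then [m] embeds all of [T] in [D], the tags [e true] and
   [e false] keeping the two cases apart, and the pairing pulls back along [m]. *)
have [TD|DT] := card_le_total (~` D) D.
  have [j jD jI] := card_le_fun TD.
  have [m mI mD] : exists2 m : T -> T, injective m & forall x, D (m x).
    exists (fun x => if pselect (D x) then q x (e true) else q (j x) (e false)).
      move=> x x'; case: pselect => dx; case: pselect => dx'.
      - by move=> /(qI _ _ _ _ dx (De _) dx' (De _))[].
      - by move=> /(qI _ _ _ _ dx (De _) (jD _ dx') (De _))[_ /tagI].
      - by move=> /(qI _ _ _ _ (jD _ dx) (De _) dx' (De _))[_ /tagI].
      - by move=> /(qI _ _ _ _ (jD _ dx) (De _) (jD _ dx') (De _))[/(jI _ _ dx dx')].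
    by move=> x; case: pselect => dx; apply: qD => //; exact: jD.
  exists (fun x y => q (m x) (m y)) => x y x' y'.
  by move=> /(qI _ _ _ _ (mD _) (mD _) (mD _) (mD _))[/mI -> /mI ->].
have [g gD gI] := card_le_fun DT.
pose D' x := D x \/ exists2 u, D u & x = g u.
have /choice[u uP] (x : T) : exists ub : T * bool,
    D' x -> D ub.1 /\ x = if ub.2 then ub.1 else g ub.1.
  have [[Dx|[u Du ->]]|nx] := pselect (D' x).
  - by exists (x, true).
  - by exists (u, false).
  - by exists (x, true).
pose c x := q (u x).1 (e (u x).2).
have cD x : D' x -> D (c x) by move=> /uP[? _]; apply: qD.
have cI x x' : D' x -> D' x' -> c x = c x' -> x = x'.
  move=> /uP[dx xE] /uP[dx' xE'].
  move=> /(qI _ _ _ _ dx (De _) dx' (De _))[E1 /tagI E2].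
  by rewrite xE E1 E2 -xE'.
(* The map [c] embeds [D'] in [D]. The values of [G'] lie in the image of [g], outside [D], so they
   cannot collide with values of the old graph. *)
pose G' : set (T * T * T) := [set p | [/\ D' p.1.1, D' p.1.2,
  ~ (D p.1.1 /\ D p.1.2) & p.2 = g (q (c p.1.1) (c p.1.2))]].
have gcI x y x' y' : D' x -> D' y -> D' x' -> D' y' ->
    g (q (c x) (c y)) = g (q (c x') (c y')) -> x = x' /\ y = y'.
  move=> dx dy dx' dy'.
  move=> /(gI _ _ (qD _ _ (cD _ dx) (cD _ dy)) (qD _ _ (cD _ dx') (cD _ dy'))).
  move=> /(qI _ _ _ _ (cD _ dx) (cD _ dy) (cD _ dx') (cD _ dy')).
  by move=> [/(cI _ _ dx dx') -> /(cI _ _ dy dy') ->].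
have gq x y : D' x -> D' y -> D' (g (q (c x) (c y))).
  by move=> dx dy; right; exists (q (c x) (c y)) => //; apply: qD; exact: cD.
have D'E x : D' x <-> exists z, (G `|` G') (x, x, z).
  split=> [D'x|[z [Gz|[]//]]]; last by left; exists z.
  have [[z Gz]|nDx] := pselect (D x); first by exists z; left.
  by exists (g (q (c x) (c x))); right; split=> // -[].
exfalso; apply: (Gmax (G `|` G')).
  split=> [p Gp|sub]; first by left.
  have D'g : D' (g (e 0)) by right; exists (e 0).
  have /sub/fld[/(gD _ (De 0))//] :
      (G `|` G') (g (e 0), g (e 0), g (q (c (g (e 0))) (c (g (e 0))))).
  by right; split=> //= -[/(gD _ (De 0))].
split; last by move=> _ p /G0G; left.
split.
- move=> x y /D'E dx /D'E dy.
  have [[Dx Dy]|n] := pselect (D x /\ D y).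
    by exists (q x y); left; exact: qG.
  by exists (g (q (c x) (c y))); right.
- move=> x y z [/fld[dx dy dz]|[/= dx dy n ->]].
    by split; apply/D'E; left.
  by split; apply/D'E => //; exact: gq.
- move=> x y z z' [Gz|[/= dx dy n ->]] [Gz'|[/= dx' dy' n' ->]] //.
  + exact: fn Gz Gz'.
  + by case: n'; have [] := fld _ _ _ Gz.
  + by case: n; have [] := fld _ _ _ Gz'.
- move=> x y x' y' z [Gz|[/= dx dy n zE]] [Gz'|[/= dx' dy' n' zE']].
  + exact: ij Gz Gz'.
  + have [_ _] := fld _ _ _ Gz; rewrite zE' => ?.
    by case: (gD _ (qD _ _ (cD _ dx') (cD _ dy'))).
  + have [_ _] := fld _ _ _ Gz'; rewrite zE => ?.
    by case: (gD _ (qD _ _ (cD _ dx) (cD _ dy))).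
  + by apply: gcI => //; rewrite -zE.
Qed.

(** Folding the pairing over a list need not determine its length, so the length is stored beside
    the fold. *)
Lemma card_seq_le (T : Type) : infinite_set [set: T] ->
  [set: seq T] #<= [set: T].
Proof.
move=> Tinf; have [p pI] := infinite_pairing Tinf.
have [e eI] := infinite_nat_inj Tinf.
apply/card_leTTP; exists (fun s => p (e (size s)) (foldr p (e 0) s)) => s t.
move=> /pI[/eI]; elim: s t => [|x s IHs] [|y t] //= [/IHs{}IHs] /pI[-> /IHs ->//].
Qed.

Lemma infinite_nat_sum (T : Type) : infinite_set [set: nat + T].
Proof. by apply/infiniteP/card_leTTP; exists inl => x y []. Qed.

Lemma card_nat_sum_le (T : Type) : infinite_set [set: T] ->
  [set: nat + T] #<= [set: T].
Proof.
move=> Tinf; have [p pI] := infinite_pairing Tinf.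
have [e eI] := infinite_nat_inj Tinf.
apply/card_leTTP; exists (fun z => match z with
  inl n => p (e 0) (e n) | inr x => p (e 1) x end).
by move=> [n|x] [m|y] /pI[/eI// _]; [move=> /eI ->|move=> ->].
Qed.

(** For finite [X] the sum is countable, and for infinite [X] it embeds in [X]. Together with
    [hull_card_le] this keeps hulls of smaller sets small. *)
Lemma card_lt_nat_sum (A : Type) (X : set A) : ~ countable [set: A] ->
  card_lt X [set: A] -> ~ ([set: A] #<= [set: nat + X]).
Proof.
move=> Aunc [_ nAX] AX.
have [Xfin|Xinf] := pselect (finite_set [set: X]).
  apply: Aunc; apply: sub_countable AX _.
  have /countable_injP[f fI] := finite_set_countable Xfin.
  apply/card_leTTP.
  exists (fun z => match z with inl n => n.*2 | inr x => (f x).*2.+1 end).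
  move=> [n|x] [m|y] /=.
  - by move=> /double_inj ->.
  - by move=> /(congr1 odd) /=; rewrite !odd_double.
  - by move=> /(congr1 odd) /=; rewrite !odd_double.
  - by move=> [] /double_inj /(fI _ _ (in_setT _) (in_setT _)) ->.
apply: nAX; rewrite -(card_le_eqr (card_setT X)).
exact: card_le_trans AX (card_nat_sum_le Xinf).
Qed.

Lemma card_tree_le (T : Type) : [set: GenTree.tree T] #<= [set: nat + T].
Proof.
apply: card_le_trans (card_seq_le (@infinite_nat_sum T)).
apply/card_leTTP; exists (@GenTree.encode T).
exact: pcan_inj (GenTree.codeK T).
Qed.

(** * Hulls *)

(** The operations take lists, so that one sequence [F] can hold functions of every arity. *)
Inductive hull (A : Type) (F : nat -> seq A -> A) (X : set A) : A -> Prop :=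
| hull_in x of X x : hull F X x
| hull_app c s of (forall x, List.In x s -> hull F X x) : hull F X (F c s).

Section HullTheory.
Variables (A : Type) (F : nat -> seq A -> A).

Lemma hullS (X Y : set A) : X `<=` Y -> hull F X `<=` hull F Y.
Proof. by move=> XY x; elim=> [y /XY|c s _ IHs]; [exact: hull_in|exact: hull_app]. Qed.

Fixpoint tree_eval (X : set A) (t : GenTree.tree (set_type X)) : A :=
  match t with
  | GenTree.Leaf x => set_val x
  | GenTree.Node c ts => F c (map (@tree_eval X) ts)
  end.

(** Every element of the hull is the value of a term with constants in [X], and terms are finite
    trees. *)
Lemma hull_card_le (X : set A) : hull F X #<= [set: nat + X].
Proof.
have XE : hull F X `<=` range (@tree_eval X).
  move=> x; elim=> [y Xy|c s _ IHs].
    by exists (GenTree.Leaf (SigSub (mem_set Xy))).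
  suff [ts <-] : exists ts, map (@tree_eval X) ts = s by exists (GenTree.Node c ts).
  elim: s IHs => [|y s IHs] h; first by exists [::].
  have [|ts <-] := IHs; first by move=> z zs; apply: h; right.
  by have [|t _ <-] := h y; [left|exists (t :: ts)].
apply: card_le_trans (subset_card_le XE) _.
exact: card_le_trans (card_image_le _ _) (card_tree_le _).
Qed.

Lemma hull_card_lt (X : set A) : ~ countable [set: A] ->
  card_lt X [set: A] -> card_lt (hull F X) [set: A].
Proof.
move=> Aunc XA; split; first exact: card_leT.
move=> /card_le_trans/(_ (hull_card_le X)); exact: card_lt_nat_sum Aunc XA.
Qed.

(** An element of the hull depends on finitely many generators, and in a directed family these lie
    in a single member. *)
Lemma hull_bigcup (K : Type) (P : set K) (X_ : K -> set A) : P !=set0 ->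
  (forall a b, P a -> P b ->
     exists c, [/\ P c, X_ a `<=` X_ c & X_ b `<=` X_ c]) ->
  hull F (\bigcup_(a in P) X_ a) `<=` \bigcup_(a in P) hull F (X_ a).
Proof.
move=> [a0 Pa0] dir x; elim=> [y [a Pa ya]|c s _ IHs].
  by exists a => //; exact: hull_in.
suff [a Pa sa] : exists2 a, P a & forall x, List.In x s -> hull F (X_ a) x.
  by exists a => //; exact: hull_app.
elim: s IHs => [|y s IHs] h; first by exists a0.
have [|a Pa sa] := IHs; first by move=> z zs; apply: h; right.
have [|b Pb yb] := h y; first by left.
have [d [Pd ad bd]] := dir _ _ Pa Pb; exists d => // z [<-|zs].
  exact: hullS yb.
exact: hullS (sa _ zs).
Qed.

End HullTheory.

(** * Well-orders *)

Section WellOrder.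
Variables (K : eqType) (le : rel K).
Hypothesis wo : well_order le.

Lemma wo_min (P : K -> Prop) : (exists x, P x) ->
  exists2 z, P z & forall x, P x -> le z x.
Proof.
move=> [x Px]; have [|z [[zP zle] _]] := wo (A := [pred x | `[< P x >]]).
  by exists x; rewrite inE.
exists z; first by move: zP; rewrite inE.
by move=> y Py; apply: zle; rewrite inE.
Qed.

Lemma wo_refl x : le x x.
Proof. by have [|z -> /(_ x erefl)] := @wo_min (eq^~ x); first by exists x. Qed.

Lemma wo_total x y : le x y \/ le y x.
Proof.
have [|z [->|->] h] := @wo_min (fun z => z = x \/ z = y).
- by exists x; left.
- by left; apply: h; right.
- by right; apply: h; left.
Qed.

(** Both points are minima of the pair, and [well_order] makes minima unique. *)
Lemma wo_anti x y : le x y -> le y x -> x = y.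
Proof.
move=> xy yx; have [|z [_ zU]] := wo (A := [pred z | (z == x) || (z == y)]).
  by exists x; rewrite inE eqxx.
rewrite -(zU x) ?(zU y) //.
  by split; rewrite ?inE ?eqxx ?orbT // => t; rewrite inE => /orP[]/eqP-> //; exact: wo_refl.
by split; rewrite ?inE ?eqxx // => t; rewrite inE => /orP[]/eqP-> //; exact: wo_refl.
Qed.

Lemma wo_trans x y z : le x y -> le y z -> le x z.
Proof.
move=> xy yz; have [|m mP h] := @wo_min (fun m => [\/ m = x, m = y | m = z]).
  by exists x; constructor 1.
case: mP h => -> h.
- by apply: h; constructor 3.
- by rewrite (wo_anti xy (h _ _)) //; constructor 1.
- by rewrite -(wo_anti yz (h _ _)) //; constructor 2.
Qed.

Lemma slt_irrefl x : ~ slt le x x.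
Proof. by case. Qed.

Lemma nslt_le x y : ~ slt le x y -> le y x.
Proof.
move=> nxy; have [xy|//] := wo_total x y.
by have [->|nE] := pselect (x = y); [exact: wo_refl|case: nxy].
Qed.

Lemma slt_le_trans x y z : slt le x y -> le y z -> slt le x z.
Proof.
move=> [xy ne] yz; split; first exact: wo_trans yz.
by move=> E; subst z; apply: ne; exact: wo_anti.
Qed.

End WellOrder.

Lemma initial_order_exists (T : Type) : exists (K : eqType) (le : rel K),
  initial_order le /\ [set: K] #= [set: T].
Proof.
have [le wo] := well_ordering_principle {classic T}.
(* If [T] embeds in a proper initial segment, the segment below the least such [a] is an initial
   order; otherwise the whole order is one. *)
have [|nex] := pselect (exists a : {classic T}, [set: T] #<= [set b | slt le b a]).
  move=> /(wo_min wo)[a Ta amin].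
  pose D := [set b | slt le b a].
  exists (set_type D), (fun x y => le (set_val x) (set_val y)).
  have cD : [set: set_type D] #= [set: T].
    rewrite (card_eql (card_setT D)); apply/card_eqPle; split=> //.
    exact: card_leT.
  split=> //; split.
    move=> P [x Px].
    have [|z [y Py <-] zmin] := @wo_min _ _ wo (fun z => exists2 y, y \in P & set_val y = z).
      by exists (set_val x), x.
    exists y; split; first by split=> // u uP; apply: zmin; exists u.
    move=> y' [y'P y'min]; apply: val_inj; apply: (wo_anti wo).
      by apply: zmin; exists y'.
    exact: y'min.
  move=> b; split; first exact: card_leT.
  have [/= ba bna] : slt le (set_val b) a by exact: (set_valP b).
  rewrite (card_le_eql cD) => Tb; apply: bna; apply: (wo_anti wo) => //.
  apply: amin; apply: card_le_trans Tb _.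
  rewrite -(card_le_eql (inj_card_eq (in2W (@val_inj _ _ _)))).
  by apply: subset_card_le => _ [c [cb nE] <-]; split=> // /val_inj.
exists {classic T}, le; split=> //; split=> // a; split; first exact: card_leT.
by move=> Ta; apply: nex; exists a.
Qed.

(** * Elementary substructures and filtrations *)

(* The scope k is not recorded in the code: it is an argument of the decoder. *)
Fixpoint formula_encode (I : countType) (k : nat) (phi : formula I k) :
    GenTree.tree nat :=
  match phi with
  | FEq _ x y => GenTree.Node 0 [:: GenTree.Leaf (x : nat); GenTree.Leaf (y : nat)]
  | FRel _ i x y => GenTree.Node 1 [:: GenTree.Leaf (choice.pickle i);
                      GenTree.Leaf (x : nat); GenTree.Leaf (y : nat)]
  | FNot _ p => GenTree.Node 2 [:: formula_encode p]
  | FAnd _ p q => GenTree.Node 3 [:: formula_encode p; formula_encode q]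
  | FEx _ p => GenTree.Node 4 [:: formula_encode p]
  end.

Fixpoint formula_decode (I : countType) (t : GenTree.tree nat) (k : nat) :
    option (formula I k) :=
  match t with
  | GenTree.Node 0 [:: GenTree.Leaf x; GenTree.Leaf y] =>
    if (insub x, insub y) is (Some x, Some y) then Some (FEq I x y) else None
  | GenTree.Node 1 [:: GenTree.Leaf i; GenTree.Leaf x; GenTree.Leaf y] =>
    if (choice.unpickle i, insub x, insub y) is (Some i, Some x, Some y)
    then Some (FRel i x y) else None
  | GenTree.Node 2 [:: p] => omap (@FNot I k) (formula_decode I p k)
  | GenTree.Node 3 [:: p; q] =>
    if (formula_decode I p k, formula_decode I q k) is (Some p, Some q)
    then Some (FAnd p q) else None
  | GenTree.Node 4 [:: p] => omap (@FEx I k) (formula_decode I p k.+1)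
  | _ => None
  end.

Lemma formula_encodeK (I : countType) (k : nat) (phi : formula I k) :
  formula_decode I (formula_encode phi) k = Some phi.
Proof.
elim: phi => {k} [k x y|k i x y|k p IHp|k p IHp q IHq|k p IHp] /=.
- by rewrite !valK.
- by rewrite choice.pickleK !valK.
- by rewrite IHp.
- by rewrite IHp IHq.
- by rewrite IHp.
Qed.

Section VCons.
Variables (T : Type) (k : nat).

Lemma vcons0 (a : T) (v : 'I_k -> T) : vcons a v ord0 = a.
Proof. by rewrite /vcons unlift_none. Qed.

Lemma vcons_lift (a : T) (v : 'I_k -> T) j : vcons a v (lift ord0 j) = v j.
Proof. by rewrite /vcons liftK. Qed.

Lemma comp_vcons (U : Type) (f : T -> U) (a : T) (v : 'I_k -> T) :
  f \o vcons a v = vcons (f a) (f \o v).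
Proof. by apply: funext => i; rewrite /vcons /=; case: unlift. Qed.

End VCons.

Lemma nth_codom_ord (T : Type) (x0 : T) (k : nat) (v : 'I_k -> T) (i : 'I_k) :
  nth x0 [seq v j | j <- enum 'I_k] i = v i.
Proof. by rewrite (nth_map i) ?nth_ord_enum // size_enum_ord. Qed.

Definition skolem_family (I : {fset nat}) (A : hyperspace I)
    (F : nat -> seq A -> A) : Prop :=
  forall k (phi : formula I k.+1), exists c, forall v : 'I_k -> A,
    (exists a, sat phi (vcons a v)) ->
    sat phi (vcons (F c [seq v j | j <- enum 'I_k]) v).

Lemma skolem_family_exists (I : {fset nat}) (A : hyperspace I) (a0 : A) :
  exists F, @skolem_family I A F.
Proof.
(* The number codes a scope and a formula, and the list holds the parameters. The value is [a0] when
   the code is invalid or no witness exists. *)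
have /choice[F FP] (cs : nat * seq A) : exists b, forall k t phi,
    choice.unpickle cs.1 = Some (k, t) -> formula_decode I t k.+1 = Some phi ->
    let v := fun i : 'I_k => nth a0 cs.2 i in
    (exists a, sat phi (vcons a v)) -> sat phi (vcons b v).
  case: (choice.unpickle cs.1) => [[k t]|]; last by exists a0.
  case E : (formula_decode I t k.+1) => [phi|]; last first.
    by exists a0 => k' t' phi [? ?]; subst k' t'; rewrite E.
  have [[b bP]|n] :=
    pselect (exists a, sat phi (vcons a (fun i : 'I_k => nth a0 cs.2 i))).
    by exists b => k' t' phi' [? ?]; subst k' t'; rewrite E => -[<-].
  by exists a0 => k' t' phi' [? ?]; subst k' t'; rewrite E => -[<-].
exists (fun c s => F (c, s)) => k phi.
exists (choice.pickle (k, formula_encode phi)) => v ex.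
have := FP (choice.pickle (k, formula_encode phi), [seq v j | j <- enum 'I_k])
  k (formula_encode phi) phi (choice.pickleK _) (formula_encodeK _) => /=.
have -> : (fun i : 'I_k => nth a0 [seq v j | j <- enum 'I_k] i) = v.
  by apply: funext => i; exact: nth_codom_ord.
exact.
Qed.

(** This is the Tarski-Vaught test: only the existential case uses closure, applied to the Skolem
    witness for the given parameters. *)
Lemma closed_elementary (I : {fset nat}) (A : hyperspace I)
    (F : nat -> seq A -> A) (B : set A) : skolem_family F ->
  (forall c s, (forall x, List.In x s -> B x) -> B (F c s)) -> elementary B.
Proof.
move=> Fsk Bcl k; elim=> {k} [k x y|k i x y|k p IHp|k p IHp q IHq|k p IHp] v /=.
- by split=> [->//|/val_inj].
- by [].
- by rewrite IHp.
- by rewrite IHp IHq.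
split=> [[a /IHp pa]|[a pa]].
  by exists (val a); move: pa; rewrite -[X in sat _ X]/(val \o _) comp_vcons.
have [c /(_ (val \o v)) cP] := Fsk _ p.
set b := F c _ in cP.
have Bb : B b.
  apply: Bcl => x /List.in_map_iff[j [<- _]].
  exact: (set_valP (v j)).
exists (SigSub (mem_set Bb)); apply/IHp.
rewrite -[X in sat _ X]/(val \o _) comp_vcons; apply: cP; by exists a.
Qed.

(** If [m] were the largest element, [K] would be the segment below [m] plus one point, and so embed
    in the sum of [nat] and a smaller set; [inl 0] stands for [m]. *)
Lemma initial_order_unbounded (K : eqType) (le : rel K) : initial_order le ->
  ~ countable [set: K] -> forall m, exists y, slt le m y.
Proof.
move=> [wo lt] unc m; apply: contrapT => /forallNP nex.
apply: (card_lt_nat_sum unc (lt m)); apply/card_leTTP.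
exists (fun x => if pselect (slt le x m) is left xm
                 then inr (SigSub (mem_set (xm : [set b | slt le b m] x))) else inl 0).
move=> x y; case: pselect => xm; case: pselect => ym //.
  by move=> [].
move=> _; have nE z : ~ slt le z m -> z = m.
  by move=> nzm; apply: contrapT => ne; apply: nzm; split=> //; apply: nslt_le.
by rewrite (nE _ xm) (nE _ ym).
Qed.

Lemma filtration_exists (I : {fset nat}) (A : hyperspace I) (G : nat -> A -> A) :
  ~ countable [set: A] ->
  exists F : filtration A, forall a c x, F a x -> F a (G c x).
Proof.
move=> unc.
have [a0 _] : [set: A] !=set0.
  by apply/set0P/eqP => A0; apply: unc; rewrite A0.
have [S Ssk] := skolem_family_exists a0.
(* Even codes are Skolem functions and odd codes apply [G] to the first argument, so hulls are
   closed under both. *)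
pose H c s := if odd c then G c./2 (head a0 s) else S c./2 s.
have [K [le [ini KA]]] := initial_order_exists A.
have [wo lt] := ini.
have uncK : ~ countable [set: K] by rewrite (eq_countable KA).
have unb := initial_order_unbounded ini uncK.
have [j jI] : exists j : A -> K, injective j.
  by apply/card_leTTP; have /card_eqPle[] := KA.
pose X a : set A := [set x | slt le (j x) a].
have XS a b : le a b -> X a `<=` X b.
  by move=> ab x xa; exact: slt_le_trans xa ab.
have cX a : card_lt (hull H (X a)) [set: A].
  apply: hull_card_lt => //; split; first exact: card_leT.
  move=> AX; have [_] := lt a; apply; rewrite (card_le_eql KA).
  apply: card_le_trans AX _.
  rewrite -(card_le_eql (inj_card_eq (in2W jI))).
  by apply: subset_card_le => _ [x xa <-].
have el a : elementary (hull H (X a)).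
  apply: (closed_elementary Ssk) => c s sP.
  have -> : S c s = H c.*2 s by rewrite /H odd_double doubleK.
  exact: hull_app.
have ct b : is_limit le b ->
    hull H (X b) = \bigcup_(a in [set a | slt le a b]) hull H (X a).
  move=> [nz ns]; apply/seteqP; split; last first.
    by move=> x [a [ab _]]; apply: hullS; exact: XS.
  have XE : X b `<=` \bigcup_(a in [set a | slt le a b]) X a.
    (* If no earlier [X a] contained [x], then [b] would be the successor of [j x]. *)
    move=> x xb; apply: contrapT => nx; apply: (ns (j x)); split=> // c xc.
    by apply: nslt_le => // cb; apply: nx; exists c.
  apply: subset_trans (hullS XE) _; apply: hull_bigcup.
    by apply: contrapT => ne; apply: nz => c cb; apply: ne; exists c.
  move=> a a' ab a'b; have [aa'|a'a] := wo_total wo a a'.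
    by exists a'; split=> //; exact: XS.
  by exists a; split=> //; exact: XS.
have un : \bigcup_(a in [set: K]) hull H (X a) = [set: A].
  apply/seteqP; split=> // x _; have [y xy] := unb (j x).
  by exists y => //; exact: hull_in.
exists (Filtration ini KA cX el (fun a b ab => hullS (XS a b ab)) ct un).
move=> a c x /= Fx; have -> : G c x = H c.*2.+1 [:: x].
  by rewrite /H /= odd_double /= uphalf_double.
by apply: hull_app => y [<-|[]].
Qed.

(** * From colorings to twistedness *)

Lemma rel_of_refl (I : {fset nat}) (A : hyperspace I) i (x : A) : rel_of i x x.
Proof. by have [r _ _] := rel_of_equiv A i; exact: r. Qed.

Lemma rel_of_sym (I : {fset nat}) (A : hyperspace I) i (x y : A) :
  rel_of i x y -> rel_of i y x.
Proof. by have [_ s _] := rel_of_equiv A i; exact: s. Qed.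

Lemma rel_of_trans (I : {fset nat}) (A : hyperspace I) i (x y z : A) :
  rel_of i x y -> rel_of i y z -> rel_of i x z.
Proof. by have [_ _ t] := rel_of_equiv A i; exact: t. Qed.

Lemma countable_enum (T : Type) (S : set T) (x0 : T) : countable S ->
  exists g : nat -> T, S `<=` range g.
Proof.
move=> /countable_injP[f fI].
have /choice[g gP] (n : nat) : exists x, (exists2 y, S y & f y = n) -> S x /\ f x = n.
  have [[y Sy yn]|ne] := pselect (exists2 y, S y & f y = n); first by exists y.
  by exists x0.
exists g => x Sx; exists (f x) => //.
have [Sg gE] : S (g (f x)) /\ f (g (f x)) = f x by apply: gP; exists x.
by apply: fI => //; exact: mem_set.
Qed.

(** A point of color [i] in the intersection lies in the [i]-class of [a], so each of the finitely
    many colors contributes finitely many points. *)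
Lemma acceptable_bigcap_finite (I : {fset nat}) (A : hyperspace I) (chi : A -> I) :
  acceptable chi ->
  forall a : A, finite_set (\bigcap_(i in [set: I]) eqclass i a).
Proof.
move=> chiP a.
apply: (@sub_finite_set _ _ (\bigcup_(i in [set: I]) [set x | eqclass i a x /\ chi x = i])).
  by move=> x xP; exists (chi x) => //; split=> //; exact: xP.
by apply: bigcup_finite => // i _; exact: chiP.
Qed.

Lemma acceptable_twisted (I : {fset nat}) (A : hyperspace I) (chi : A -> I) :
  acceptable chi -> twisted A.
Proof.
(* The induction runs over a type equipotent to [A], with index set and coloring left free, because
   the new parts have other carriers and other index sets. *)
have [T] : exists T : Type, [set: A] #= [set: T] by exists A.
elim/card_lt_ind: T I A chi => T IH I A chi AT chiP.
have capf := acceptable_bigcap_finite chiP.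
have [cA|unc] := pselect (countable [set: A]); first exact: twisted_countable.
have /choice[g gP] (bi : A * I) :
    exists g : nat -> A, [set x | eqclass bi.2 bi.1 x /\ chi x = bi.2] `<=` range g.
  by apply: countable_enum bi.1 _; apply: finite_set_countable; exact: chiP.
(* The code of [(i, n)] gives the [n]-th entry of a list covering the points of color [i] in the
   [i]-class of [x]. *)
pose G c x := if choice.unpickle c is Some (i, n) then g (x, i) n else x.
have [F FG] := filtration_exists G unc.
have Fcl a b y : F a b -> rel_of (chi y) b y -> F a y.
  move=> Fb by_; have [n _ <-] := gP (b, chi y) y (conj by_ erefl).
  have -> : g (b, chi y) n = G (choice.pickle (chi y, n)) b.
    by rewrite /G choice.pickleK.
  exact: FG.
have small a (B : set A) : B `<=` F a -> card_lt [set: set_type B] [set: T].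
  move=> BF; have [_ nAF] := fset_at_card a; split.
    by rewrite -(card_le_eqr AT) (card_le_eql (card_setT B)) card_leT.
  rewrite -(card_le_eql AT) (card_le_eqr (card_setT B)) => AB; apply: nAF.
  exact: card_le_trans AB (subset_card_le BF).
apply: (twisted_uncountable (F := F)) => // [z _|a a' J JI succ J0].
  apply: (IH _ (small z (F z) (fun _ h => h)) I (Defs.restrict (F z))
    (fun x : Defs.restrict (F z) => chi (val x))) => //.
  move=> x i; apply: (finite_preimage (f := val) _ (chiP (val x) i)).
  by move=> ? ? _ _; exact: val_inj.
set B := new_part _ _ _.
(* The color of [x] belongs to [J]: otherwise its class for that color meets [F a], and [Fcl] puts
   [x] in [F a]. *)
have /choice[d dP] (x : set_type B) : exists j : J, fincl JI j = chi (val x).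
  have [_ nFx /(_ (chi (val x)))[_ inJ]] := set_valP x.
  have {}inJ : val (chi (val x)) \in J.
    apply: inJ; rewrite -subset0 => y [xy Fy].
    by apply: nFx; apply: Fcl Fy (rel_of_sym xy).
  by exists [` inJ]%fset; apply: val_inj.
have BF : B `<=` F a' by move=> x [].
apply: (IH _ (small a' B BF) J (reduct JI (Defs.restrict B)) d) => // x j.
apply: (@sub_finite_set _ _ (val @^-1` [set y | eqclass (fincl JI j) (val x) y /\
    chi y = fincl JI j])).
  by move=> y [xy yj]; split; [exact: xy|rewrite -dP yj].
apply: finite_preimage (chiP _ _).
by move=> ? ? _ _; exact: val_inj.
Qed.

(** * From twistedness to colorings *)

(** The seed [FEq I ord0 ord0] serves as the true formula; it needs a variable, hence the scope
    [k.+1]. *)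
Definition bigand (I : Type) (k : nat) (T : finType) (f : T -> formula I k.+1) :
    formula I k.+1 :=
  foldr (fun t => FAnd (f t)) (FEq I ord0 ord0) (enum T).

Lemma sat_bigand (I : {fset nat}) (A : hyperspace I) (k : nat) (T : finType)
    (f : T -> formula I k.+1) (v : 'I_k.+1 -> A) :
  sat (bigand f) v <-> forall t, sat (f t) v.
Proof.
suff -> : sat (bigand f) v <-> forall t, t \in enum T -> sat (f t) v.
  by split=> h t; [apply: h; rewrite mem_enum|move=> _].
rewrite /bigand; elim: (enum T) => [|t s IHs] /=; first by split.
rewrite IHs; split=> [[ft fs] u|h]; last first.
  by split=> [|u us]; apply: h; rewrite inE ?eqxx ?us ?orbT.
by rewrite inE => /predU1P[->//|]; exact: fs.
Qed.

(* The intersection of the classes of x is finite and definable from parameters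
   in B, and B knows all of its own elements in it; hence it has no others. *)
Lemma elementary_bigcap_mem (I : {fset nat}) (A : hyperspace I) (B : set A) (x : A) :
  elementary B -> finite_set (\bigcap_(i in [set: I]) eqclass i x) ->
  (forall i, exists2 b, B b & rel_of i x b) -> B x.
Proof.
move=> elB fin ex; apply: contrapT => nBx.
have /choice[b bP] (i : I) : exists b : Defs.restrict B, rel_of i x (val b).
  by have [b Bb xb] := ex i; exists (SigSub (mem_set Bb)).
have /finite_seqP[s sE] : finite_set (val @^-1` (\bigcap_(i in [set: I]) eqclass i x)
    : set {classic (Defs.restrict B)}).
  by apply: finite_preimage fin => ? ? _ _; exact: val_inj.
pose m := size s.
pose w (j : 'I_(#|{: I}| + m)) : Defs.restrict B :=
  match fintype.split j with inl i => b (enum_val i) | inr j => tnth (in_tuple s) j end.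
(* The formula asks for a point equivalent to every [b i] and different from every member of [s]. In
   [A] the point [x] satisfies it, but a witness in [B] would lie in the intersection, hence in
   [s]. *)
pose phi : formula I (#|{: I}| + m) := FEx (FAnd
  (bigand (fun i : I => FRel i ord0 (lift ord0 (lshift m (enum_rank i)))))
  (bigand (fun j : 'I_m => FNot (FEq I ord0 (lift ord0 (rshift #|{: I}| j)))))).
have wl i : w (lshift m (enum_rank i)) = b i.
  by rewrite /w (unsplitK (inl _ _)) enum_rankK.
have wr j : w (rshift #|{: I}| j) = tnth (in_tuple s) j.
  by rewrite /w (unsplitK (inr _ _)).
have [_ [|y []]] := elB _ phi w.
  exists x; split; apply/sat_bigand => t /=; rewrite vcons0 vcons_lift.
    by rewrite wl.
  by move=> xE; apply: nBx; rewrite xE; exact: set_valP.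
move=> /sat_bigand yb /sat_bigand ys.
have : y \in s.
  have : [set` s] y; last by [].
  rewrite -sE => i _ /=; have := yb i; rewrite /= vcons0 vcons_lift wl => ybi.
  exact: rel_of_trans (bP i) (rel_of_sym ybi).
move=> /(tnthP (in_tuple s))[j yE].
by have := ys j; rewrite /= vcons0 vcons_lift wr; apply.
Qed.

Lemma countable_coloring (I : {fset nat}) (A : hyperspace I) : I ->
  (forall a : A, finite_set (\bigcap_(i in [set: I]) eqclass i a)) ->
  countable [set: A] -> exists chi : A -> I, acceptable chi.
Proof.
move=> i0 fin /countable_injP[f fI].
have /choice[h hP] (S : set A) : exists n, S !=set0 -> exists2 x, S x & f x = n.
  by have [[x Sx]|ne] := pselect (S !=set0); [exists (f x) => _; exists x|exists 0].
pose m i x := h (eqclass i x).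
have mE i x y : rel_of i x y -> m i x = m i y.
  move=> xy; congr h; apply/seteqP; split=> z.
    exact: rel_of_trans (rel_of_sym xy).
  exact: rel_of_trans xy.
have mI i x y : m i x = m i y -> rel_of i x y.
  rewrite /m; have [|u xu <-] := hP (eqclass i x); first by exists x; exact: rel_of_refl.
  have [|v yv <-] := hP (eqclass i y); first by exists y; exact: rel_of_refl.
  move=> /(fI _ _ (in_setT _) (in_setT _)) uv; subst v.
  exact: rel_of_trans xu (rel_of_sym yv).
exists (fun x => [arg max_(i > i0) m i x])%N => a i.
(* If [x] in the [i]-class of [a] has color [i], all codes [m j x] are at most [N], so their vector
   is one of finitely many [t]. Points with the same vector share all their classes. *)
pose N := m i a.
apply: (@sub_finite_set _ _ (\bigcup_(t in [set: {ffun I -> 'I_N.+1}])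
    [set x | forall j, m j x = t j])).
  move=> x [ax]; case: arg_maxnP => // k _ kmax kE; subst k.
  exists [ffun j => inord (m j x)] => // j; rewrite ffunE inordK //.
  by rewrite ltnS /N (mE _ _ _ ax); exact: kmax.
apply: bigcup_finite => // t _.
have [[x xP]|ne] := pselect ([set x | forall j, m j x = t j] !=set0).
  apply: sub_finite_set (fin x) => y yP i' _.
  by apply: mI; rewrite xP yP.
apply: sub_finite_set (finite_set0 _) => x xP; apply: ne; by exists x.
Qed.

(** The coloring is total on [A] with values in [I], so that colorings of different parts have the
    same type and can be glued. *)
Definition coloring_on (I : {fset nat}) (A : hyperspace I) (B : set A)
    (J : {fset nat}) (c : A -> I) : Prop :=
  (forall x, B x -> val (c x) \in J) /\
  (forall a i, finite_set [set x | [/\ B x, rel_of i a x & c x = i]]).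

Lemma coloring_on_extend (I : {fset nat}) (A : hyperspace I) (B : set A)
    (J : {fset nat}) (i0 : I) (d : set_type B -> I) :
  (forall x, val (d x) \in J) ->
  (forall (a : set_type B) i,
     finite_set [set x : set_type B | rel_of i (val a) (val x) /\ d x = i]) ->
  exists c, coloring_on B J c.
Proof.
move=> dJ dfin.
have /choice[c cP] (x : A) : exists i, forall y : set_type B, val y = x -> d y = i.
  have [[y yx]|ne] := pselect (exists y : set_type B, val y = x).
    by exists (d y) => z zx; congr d; apply: val_inj; rewrite zx.
  by exists i0 => y yx; case: ne; exists y.
have BE x : B x -> exists2 y : set_type B, val y = x & c x = d y.
  by move=> Bx; exists (SigSub (mem_set Bx)) => //; rewrite (cP x (SigSub (mem_set Bx))).
exists c; split=> [x /BE[y _ ->]//|a i].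
(* The point [a] may lie outside [B]; any element of the set in question can replace it, having the
   same class. *)
have [[x [/BE[x' xE cE] ax cx]]|ne] :=
  pselect ([set x | [/\ B x, rel_of i a x & c x = i]] !=set0).
  apply: sub_finite_set (finite_image val (dfin x' i)).
  move=> y [/BE[y' yE ->] ay dy]; exists y' => //; split=> //.
  by rewrite xE yE; exact: rel_of_trans (rel_of_sym ax) ay.
by apply: sub_finite_set (finite_set0 _) => x xP; apply: ne; exists x.
Qed.

Lemma coloring_on_restrict (I : {fset nat}) (A : hyperspace I) (B : set A)
    (i0 : I) (chi : Defs.restrict B -> I) : acceptable chi ->
  exists c, coloring_on B I c.
Proof.
move=> chiP; apply: (@coloring_on_extend _ _ _ _ i0 chi) => [x|a i].
  exact: valP.
exact: chiP.
Qed.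

Lemma coloring_on_reduct (I J : {fset nat}) (JI : (J `<=` I)%fset)
    (A : hyperspace I) (B : set A) (i0 : I)
    (chi : reduct JI (Defs.restrict B) -> J) : acceptable chi ->
  exists c, coloring_on B J c.
Proof.
move=> chiP; apply: (@coloring_on_extend _ _ _ _ i0 (fincl JI \o chi)) => [x|a i] /=.
  exact: (valP (chi x)).
have [[j <-]|ne] := pselect (exists j, fincl JI j = i).
  apply: sub_finite_set (chiP a j) => x [ax E]; split=> //.
  by apply: val_inj; have := congr1 val E.
by apply: sub_finite_set (finite_set0 _) => x [_ E]; apply: ne; exists (chi x).
Qed.

(* [lev x] is the first stage containing x, [pr] its predecessor, [newJ x] the set
   of indices of the classes of x that do not meet the predecessor stage. *)
Lemma twisted_coloring (I : {fset nat}) (A : hyperspace I) : I -> twisted A ->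
  exists chi : A -> I, acceptable chi.
Proof.
move=> i0 tw; elim: tw i0 => {I A} [I A fin cA i0|I A F fin unc _ IH0 _ IH1 i0].
  exact: countable_coloring.
have [wo _] := fidx_initial F.
set K := fidx F in wo *; set le := @fle _ _ F in wo *.
have /choice[c0 c0P] (z : K) : exists c, is_zero le z -> coloring_on (F z) I c.
  have [z0|nz] := pselect (is_zero le z); last by exists (fun=> i0).
  have [chi chiP] := IH0 _ z0 i0.
  by have [c cP] := coloring_on_restrict i0 chiP; exists c.
have /choice[c1 c1P] (q : K * K * {fset nat}) : exists c,
    is_succ le q.1.1 q.1.2 -> (q.2 `<=` I)%fset -> q.2 <> fset0 ->
    coloring_on (new_part (F q.1.1) (F q.1.2) q.2) q.2 c.
  case: q => -[a a'] J /=.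
  have [[sa [JI J0]]|n] :=
      pselect (is_succ le a a' /\ ((J `<=` I)%fset /\ J <> fset0)); last first.
    by exists (fun=> i0) => sa JI J0; case: n.
  (* The induction hypothesis asks for an index in [J]. *)
  have [j jJ] : exists j, j \in J by apply/fset0Pn/eqP.
  have [chi chiP] := IH1 _ _ _ JI sa J0 [` jJ]%fset.
  by have [c cP] := coloring_on_reduct i0 chiP; exists c.
have /choice[lev levP] (x : A) : exists a, F a x /\ forall b, F b x -> le a b.
  have [|a Fa amin] := @wo_min _ _ wo (fun a => F a x); last by exists a.
  have : [set: A] x by [].
  by rewrite -(fset_at_union F) => -[a _ Fa]; exists a.
have /choice[pr prP] (a : K) : exists b, (exists b, is_succ le b a) -> is_succ le b a.
  by have [[b ba]|ne] := pselect (exists b, is_succ le b a); [exists b|exists a].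
(* By continuity no point first appears at a limit stage. *)
have lev_pr x : ~ is_zero le (lev x) -> is_succ le (pr (lev x)) (lev x).
  move=> nz; apply: prP; apply: contrapT => /forallNP ns.
  have [Fx xmin] := levP x.
  move: Fx; rewrite (fset_at_continuous (conj nz ns)) => -[a ax /xmin xa].
  exact: (@slt_irrefl _ le a (slt_le_trans wo ax xa)).
have pr_notin x : ~ is_zero le (lev x) -> ~ F (pr (lev x)) x.
  move=> /lev_pr[prx _] Fx; have [_ /(_ _ Fx) xp] := levP x.
  exact: (@slt_irrefl _ le _ (slt_le_trans wo prx xp)).
pose isnew x : pred I := fun i => `[< eqclass i x `&` F (pr (lev x)) = set0 >].
pose newJ x : {fset nat} := [fset val i | i in isnew x]%fset.
have newJP x (i : I) : val i \in newJ x <-> eqclass i x `&` F (pr (lev x)) = set0.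
  split=> [/imfsetP[i' /=]|E]; first by move=> /asboolP E /val_inj ->.
  by apply/imfsetP; exists i => //=; apply/asboolP.
have newJI x : (newJ x `<=` I)%fset.
  by apply/fsubsetP => k /imfsetP[i _ ->]; exact: valP.
(* If no class of [x] were new, [elementary_bigcap_mem] would put [x] in the preceding stage. *)
have newJ0 x : ~ is_zero le (lev x) -> newJ x <> fset0.
  move=> nz J0; apply: (pr_notin _ nz).
  apply: (elementary_bigcap_mem (@fset_at_elementary _ _ F _) (fin x)) => i.
  have [y [xy Fy]] : eqclass i x `&` F (pr (lev x)) !=set0.
    by apply/set0P/eqP => /newJP; rewrite J0.
  by exists y.
have newx x : ~ is_zero le (lev x) ->
    new_part (F (pr (lev x))) (F (lev x)) (newJ x) x.
  by move=> nz; split; [have [] := levP x|exact: pr_notin|exact: newJP].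
exists (fun x => if pselect (is_zero le (lev x)) then c0 (lev x) x
                 else c1 (pr (lev x), lev x, newJ x) x) => a i.
have [a1 [y ay Fy] a1min] :
    exists2 a1, exists2 y, rel_of i a y & F a1 y &
      forall b, (exists2 y, rel_of i a y & F b y) -> le a1 b.
  apply: (wo_min wo); exists (lev a), a; first exact: rel_of_refl.
  by have [] := levP a.
(* A point of color [i] in the [i]-class of [a] enters at the stage [a1] where this class first
   appears. If it entered later, the preceding stage would contain [y], so [i] would not be new, yet
   [c1] uses only new indices. *)
have levE x : rel_of i a x ->
    (~ is_zero le (lev x) -> c1 (pr (lev x), lev x, newJ x) x = i) -> lev x = a1.
  move=> ax xi; apply: (wo_anti wo); last first.
    by apply: a1min; exists x => //; have [] := levP x.
  apply: (nslt_le wo) => a1x.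
  have nz : ~ is_zero le (lev x) by move=> /(_ a1).
  have [inJ _] := c1P (_, _, newJ x) (lev_pr _ nz) (newJI x) (newJ0 _ nz).
  have := inJ x (newx _ nz); rewrite /= xi // => /newJP; apply/eqP/set0P.
  exists y; split; first exact: rel_of_trans (rel_of_sym ax) ay.
  apply: (fset_at_increasing (f := F)) Fy; apply: (nslt_le wo).
  have [_ h] := lev_pr _ nz; move=> /h xa1.
  exact: (@slt_irrefl _ le _ (slt_le_trans wo a1x xa1)).
have [z1|nz1] := pselect (is_zero le a1).
  have [_ /(_ a i)] := c0P _ z1; apply: sub_finite_set => x [ax].
  case: pselect => /= zx xi.
    have xE : lev x = a1 by apply: levE => // /(_ zx).
    by split=> //; rewrite -xE //; have [] := levP x.
  by case: zx; rewrite (levE x).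
(* All points counted enter at [a1], and they are sorted by their set of new indices, of which there
   are finitely many. *)
apply: (@sub_finite_set _ _ (\bigcup_(J in [set J | (J `<=` I)%fset /\ J <> fset0])
    [set x | [/\ new_part (F (pr a1)) (F a1) J x, rel_of i a x &
                 c1 (pr a1, a1, J) x = i]])).
  move=> x [ax]; case: pselect => /= zx xi.
    by case: nz1; rewrite -(levE x).
  have xE : lev x = a1 by apply: levE.
  exists (newJ x); first by split; [exact: newJI|exact: newJ0].
  by rewrite -xE; split=> //; exact: newx.
have succ1 : is_succ le (pr a1) a1.
  apply: prP; apply: contrapT => /forallNP ns.
  move: Fy; rewrite (fset_at_continuous (conj nz1 ns)) => -[b b1 Fb].
  have := a1min b (ex_intro2 _ _ y ay Fb).
  by move=> /(slt_le_trans wo b1); exact: slt_irrefl.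
apply: bigcup_finite => [|J [JI J0]].
  apply: sub_finite_set (finite_fset (fpowerset I)) => J [JI _] /=.
  by rewrite fpowersetE.
by have [_] := c1P (pr a1, a1, J) succ1 JI J0; exact.
Qed.

Theorem theorem2p2 (n : nat) (hn : (1 <= n)%N) (A : hyperspace (nindex n)) :
  twisted A <-> exists chi : A -> nindex n, acceptable chi.
Proof.
(* By [hn] there is an index to serve as default color. *)
have n0 : 0 \in nindex n by rewrite !inE mem_iota.
split=> [|[chi]]; first exact: twisted_coloring [` n0]%fset.
exact: acceptable_twisted.
Qed.
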